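(* For any $\varepsilon>0$ and $x\geqslant e$ sufficiently large, $$\sum_{n \leqslant x} \mu_2\left(\left\lfloor \frac{x}{n}\right\rfloor\right) = x\sum_{n=1}^\infty \frac{\mu_2(n)}{n(n+1)} + O_\varepsilon\left(x^{\frac{1919}{4268}+\varepsilon}\right).$$
   Context: $\mu_2=\mu^2$ is the characteristic function of the set of squarefree positive integers, where $\mu$ is the Möbius function. $\lfloor\cdot\rfloor$ is the integer part. *)

(* Defs.v *)
From mathcomp Require Import all_boot all_order all_algebra.
From mathcomp Require Import all_classical all_reals all_analysis.
From mathcomp Require Import ring lra.
Set Implicit Arguments.
Unset Strict Implicit.
Unset Printing Implicit Defensive.
Import Order.TTheory GRing.Theory Num.Theory.
Import numFieldNormedType.Exports.
Local Open Scope ring_scope.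

Definition squarefree (n : nat) : bool :=
  (0 < n)%N && all (fun p => ~~ (p ^ 2 %| n)%N) (primes n).

Lemma squarefreeP (n : nat) :
  reflect ((0 < n)%N /\ forall d, (d ^ 2 %| n)%N -> d = 1%N) (squarefree n).
Proof.
apply: (iffP andP) => -[n0 H]; split=> //.
  move=> d dn; have d0 : (0 < d)%N.
    by case: d dn => //; rewrite dvd0n; case: n n0 H.
  case: (ltngtP d 1%N) => // [|d1]; first by rewrite ltnNge d0.
  have pd := pdiv_dvd d; have pp := pdiv_prime d1.
  have p2 : (pdiv d ^ 2 %| n)%N by apply: dvdn_trans dn; rewrite dvdn_exp2r.
  move/allP: H => /(_ (pdiv d)); rewrite p2 mem_primes pp n0 /=.
  by rewrite (dvdn_trans _ p2) ?dvdn_exp // => /(_ isT).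
apply/allP => p; rewrite mem_primes => /and3P[pp _ _].
by apply/negP => /H p1; rewrite p1 in pp.
Qed.

Definition moebius (n : nat) : int :=
  if squarefree n then (-1) ^+ size (primes n) else 0.

Definition mu2 (n : nat) : int := moebius n ^+ 2.

Lemma mu2E (n : nat) : mu2 n = (squarefree n)%:R.
Proof. by rewrite /mu2 /moebius; case: squarefree; rewrite ?sqrr_sign ?expr0n. Qed.

(* [limn] is a total operator, so the value of the series is meaningful only
   because its partial sums converge. *)
Lemma is_cvg_series_mu2 (R : realType) :
  cvgn (fun N => \sum_(1 <= n < N) (mu2 n)%:~R / (n%:R * n.+1%:R) : R).
Proof.
have ge0 n : 0 <= (mu2 n)%:~R / (n%:R * n.+1%:R) :> R.
  by rewrite divr_ge0 ?mulr_ge0 ?ler0n// mu2E; case: squarefree; rewrite ?ler01.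
apply: nondecreasing_is_cvgn.
  apply/nondecreasing_seqP => -[|n]; first by rewrite !big_geq.
  by rewrite [leRHS]big_nat_recr//= lerDl.
exists 1 => _ [N _ <-].
case: N => [|N]; first by rewrite big_geq// ler01.
suff : \sum_(1 <= n < N.+1) (mu2 n)%:~R / (n%:R * n.+1%:R) <= 1 - N.+1%:R^-1 :> R.
  by move=> /le_trans; apply; rewrite lerBlDr lerDl invr_ge0 ler0n.
elim: N => [|N IH]; first by rewrite big_geq// invr1 subrr.
rewrite big_nat_recr//=.
apply: (@le_trans _ _ (1 - N.+1%:R^-1 + (N.+1%:R * N.+2%:R)^-1)).
  apply: lerD => //; rewrite -[leRHS]mul1r ler_wpM2r ?invr_ge0 ?mulr_ge0//.
  by rewrite mu2E; case: squarefree; rewrite ?ler01.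
have a0 : N.+1%:R != 0 :> R by rewrite pnatr_eq0.
have b0 : N.+2%:R != 0 :> R by rewrite pnatr_eq0.
rewrite -natr1 in b0 *; move: (N.+1%:R : R) a0 b0 => t a0 b0.
by rewrite le_eqVlt; apply/orP; left; apply/eqP; field; rewrite a0 b0.
Qed.

(* Main.v *)
Require Import Defs.
From mathcomp Require Import all_boot all_order all_algebra.
From mathcomp Require Import all_classical all_reals all_analysis.
From mathcomp Require Import ring lra zify.
Set Implicit Arguments.
Unset Strict Implicit.
Unset Printing Implicit Defensive.
Import Order.TTheory GRing.Theory Num.Theory.
Import numFieldNormedType.Exports.
Local Open Scope ring_scope.

(** Grouping the [n <= x] by the value [m] of the integer part of [x / n] turns
    the sum into [\sum_m mu2 m * (floor (x / m) - floor (x / (m + 1)))].  At most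
    [x / (M + 1)] indices [n] give a value above [M], and replacing both floors
    by their arguments produces the partial sum of the series, whose tail is at
    most [1 / (M + 1)].  Up to [O(x / M)], the error is therefore a difference of
    two sums of [mu2 m * psi (x / (m + delta))], [m <= M], with [delta] equal to
    [0] or [1] and [psi t = {t} - 1/2].

    Opening [mu2 m] as the sum of [moebius d] over [d ^ 2 %| m]
    ([sum_moebius_sqr_dvd]) reduces these to sums of [psi (X / (k + delta'))]
    over [k <= n], where [X = x / d ^ 2] and [n = M / d ^ 2].  Such a sum is
    [O(sqrt n * X ^ (1/6))] as long as [n] is small compared with [X ^ (2/3)]
    ([sum_sawtooth_hyperbola]).  Adding this over [d] costs a convergent series
    with terms [d ^ (- 4/3)] and leaves [O(sqrt M * x ^ (1/6))].  With [M] near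
    [x ^ (5/9)] both errors are [O(x ^ (4/9))], and [4/9 < 1919/4268].

    The bound for the hyperbola is elementary. Near [k] the function [X / (k +
    delta')] follows its tangent. If the slope is within [1 / (q * Q)] of a
    reduced fraction [a / q] with [q <= Q], and [Q] is at most [k / X ^ (1/3)],
    then the next [q] values stay within [O(1 / q)] of an arithmetic progression
    of difference [a / q], which runs over all residues; Hermite's identity then
    shows that these [q] values of [psi] add up to [O(1)]
    ([sum_sawtooth_near_progression]). Blocks with [q >= sqrt n / X ^ (1/6)] are
    long enough to pay for themselves. The starting points at which only a
    smaller [q] is available are simply discarded: the slope is strictly
    monotone with a known rate, so few integers have a slope that close to a
    fraction of small denominator ([count_separated], [sum_bad_le]). *)

(** * Sawtooth sums along near-progressions *)

Definition sawtooth (R : archiRealFieldType) (t : R) : R :=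
  t - (Num.floor t)%:~R - 2^-1.

Lemma sawtooth_floor (R : archiRealFieldType) (t : R) (m : int) :
  m%:~R <= t < m%:~R + 1 -> sawtooth t = t - m%:~R - 2^-1.
Proof.
move=> h; rewrite /sawtooth (_ : Num.floor t = m)//.
by apply: floor_def; rewrite intrD.
Qed.

Lemma sawtooth_itv (R : archiRealFieldType) (t : R) : - 2^-1 <= sawtooth t < 2^-1.
Proof.
by have := floor_itv t; rewrite intrD /sawtooth => /andP[h1 h2]; apply/andP; split; lra.
Qed.

Lemma norm_sawtooth (R : archiRealFieldType) (t : R) : `|sawtooth t| <= 1.
Proof.
have /andP[h1 h2] := sawtooth_itv t.
by rewrite ler_norml; apply/andP; split; lra.
Qed.

(** The sawtooth jumps only downwards.  This one-sided Lipschitz bound lets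
    perturbations be absorbed without counting the jumps that they cause. *)
Lemma sawtooth_addr_le (R : archiRealFieldType) (t h : R) :
  0 <= h -> sawtooth (t + h) <= sawtooth t + h.
Proof.
move=> h0; have : (Num.floor t <= Num.floor (t + h)) by apply: le_floor; lra.
by rewrite -(ler_int R) /sawtooth => ?; lra.
Qed.

(** The map sending [j] to [b + a * j] permutes the residues modulo [q], as [a] is
    prime to [q]. *)
Lemma sum_modz_progression (q : nat) (a b : int) (q0 : (0 < q)%N) :
  coprimez a q ->
  \sum_(j < q) ((b + a * j%:Z) %% q)%Z = \sum_(j < q) j%:Z.
Proof.
move=> cop.
have qn0 : q%:Z != 0 by lia.
have bnd j : (`|((b + a * j%:Z) %% q)%Z| < q)%N.
  have := modz_ge0 (b + a * j%:Z) qn0.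
  by have := @ltz_pmod (b + a * j%:Z) q; lia.
pose s (j : 'I_q) : 'I_q := Ordinal (bnd (j : nat)).
have sinj : injective s.
  move=> i j /(congr1 val)/= e.
  have e' : ((b + a * i%:Z) %% q)%Z = ((b + a * j%:Z) %% q)%Z.
    have := modz_ge0 (b + a * i%:Z) qn0.
    by have := modz_ge0 (b + a * j%:Z) qn0; lia.
  have : (q %| a * (i%:Z - j%:Z))%Z.
    move/eqP: e'; rewrite eqz_mod_dvd.
    by rewrite (_ : _ - _ = a * (i%:Z - j%:Z)) //; ring.
  rewrite Gauss_dvdzr; last by rewrite coprimez_sym.
  move=> /dvdzP[k ek]; apply: val_inj => /=.
  have := ltn_ord i; have := ltn_ord j.
  case: (k =P 0) => [k0|kn]; first by move: ek; rewrite k0; lia.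
  move=> hj hi; exfalso.
  have : (1 <= `|k|)%N by lia.
  by nia.
rewrite [RHS](reindex_inj sinj) /=; apply: eq_bigr => j _.
by rewrite gez0_abs// modz_ge0.
Qed.

(** Hermite's identity: write [q * beta = b + tau] with [b] an integer and
    [0 <= tau < 1].  The fractional parts are the [(i + tau) / q] with [i] running
    over the residues, so the sum is exactly [tau - 1/2]. *)
Lemma sum_sawtooth_progression (R : archiRealFieldType) (q : nat) (a : int) (beta : R) :
  (0 < q)%N -> coprimez a q ->
  `|\sum_(j < q) sawtooth (beta + a%:~R * j%:R / q%:R)| <= 2^-1.
Proof.
move=> q0 cop.
have qR : 0 < q%:R :> R by rewrite ltr0n.
pose b := Num.floor (q%:R * beta).
pose tau := q%:R * beta - b%:~R.
have /andP[t0 t1] : 0 <= tau < 1.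
  have := floor_itv (q%:R * beta); rewrite intrD -/b /tau => /andP[h1 h2].
  by apply/andP; split; lra.
have E (j : 'I_q) : sawtooth (beta + a%:~R * j%:R / q%:R) =
    (((b + a * j%:Z) %% q)%Z%:~R + tau) / q%:R - 2^-1.
  set m := (b + a * j%:Z).
  have em : beta + a%:~R * j%:R / q%:R =
     (m %/ q)%Z%:~R + ((m %% q)%Z%:~R + tau) / q%:R.
    apply: (mulfI (lt0r_neq0 qR)).
    have : m%:~R = (m %/ q)%Z%:~R * q%:R + (m %% q)%Z%:~R :> R.
      by rewrite {1}(divz_eq m q) intrD intrM.
    rewrite {1}/m intrD intrM => h.
    rewrite (_ : q%:R * (beta + _) = q%:R * beta + a%:~R * j%:R); last by field; lra.
    rewrite [RHS](_ : _ = (m %/ q)%Z%:~R * q%:R + (m %% q)%Z%:~R + tau);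
      last by field; lra.
    by rewrite -h /tau (_ : j%:Z%:~R = j%:R)//; lra.
  rewrite em (@sawtooth_floor _ _ (m %/ q)%Z); first by lra.
  have m0 : 0 <= (m %% q)%Z by rewrite modz_ge0; lia.
  have m1 : (m %% q)%Z + 1 <= q%:Z by have := @ltz_pmod m q; lia.
  have m0' : 0 <= (m %% q)%Z%:~R :> R by rewrite ler0z.
  have m1' : (m %% q)%Z%:~R + 1 <= q%:R :> R.
    by move: m1; rewrite -(ler_int R) intrD.
  apply/andP; split; first by rewrite lerDl divr_ge0 ?(ltW qR)// addr_ge0.
  by rewrite ltrD2l ltr_pdivrMr//; lra.
rewrite (eq_bigr _ (fun j _ => E j)) sumrB -mulr_suml big_split /=.
rewrite -rmorph_sum /= (sum_modz_progression _ q0 cop) !sumr_const !card_ord.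
have S2 : forall n : nat, (\sum_(j < n) j%:Z)%:~R *+ 2 = n%:R * (n%:R - 1) :> R.
  elim=> [|n IH]; first by rewrite big_ord0; lra.
  by rewrite big_ord_recr /= intrD mulrnDl IH -(natr1 n); lra.
have := S2 q; set S := (_%:~R) => hS.
have -> : (S + tau *+ q) / q%:R - 2^-1 *+ q = tau - 2^-1.
  rewrite -[tau *+ q]mulr_natr -[2^-1 *+ q]mulr_natr.
  have -> : S = q%:R * (q%:R - 1) / 2 by lra.
  by field; lra.
by rewrite ler_norml; apply/andP; split; lra.
Qed.

(** Shifting the whole progression by [c / q] in either direction puts it above
    or below all the [y j]; [sawtooth_addr_le] then compares the two sums at a cost of
    [2 * c / q] for each term. *)
Lemma sum_sawtooth_near_progression (R : archiRealFieldType) (q : nat) (a : int)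
    (beta c : R) (y : nat -> R) :
  (0 < q)%N -> coprimez a q ->
  (forall j, (j < q)%N -> `|y j - (beta + a%:~R * j%:R / q%:R)| <= c / q%:R) ->
  `|\sum_(j < q) sawtooth (y j)| <= 2 * c + 2^-1.
Proof.
move=> q0 cop near.
have qR : 0 < q%:R :> R by rewrite ltr0n.
have S : \sum_(j < q) (2 * c / q%:R) = 2 * c.
  by rewrite sumr_const card_ord -[_ *+ q]mulr_natr; field; lra.
rewrite ler_norml; apply/andP; split.
- have := sum_sawtooth_progression (beta + c / q%:R) q0 cop.
  rewrite ler_norml => /andP[h _].
  have : \sum_(j < q) sawtooth (beta + c / q%:R + a%:~R * j%:R / q%:R) <=
         \sum_(j < q) sawtooth (y j) + \sum_(j < q) (2 * c / q%:R).
    rewrite -big_split /=; apply: ler_sum => j _.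
    have := near j (ltn_ord j); rewrite ler_norml => /andP[h1 h2].
    have := @sawtooth_addr_le R (y j)
      (beta + c / q%:R + a%:~R * j%:R / q%:R - y j).
    rewrite subrKC => H; apply: (le_trans (H _)); lra.
  by rewrite S; lra.
- have := sum_sawtooth_progression (beta - c / q%:R) q0 cop.
  rewrite ler_norml => /andP[_ h].
  have : \sum_(j < q) sawtooth (y j) <=
    \sum_(j < q) sawtooth (beta - c / q%:R + a%:~R * j%:R / q%:R) +
    \sum_(j < q) (2 * c / q%:R).
    rewrite -big_split /=; apply: ler_sum => j _.
    have := near j (ltn_ord j); rewrite ler_norml => /andP[h1 h2].
    have := @sawtooth_addr_le R (beta - c / q%:R + a%:~R * j%:R / q%:R)
      (y j - (beta - c / q%:R + a%:~R * j%:R / q%:R)).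
    rewrite subrKC => H; apply: (le_trans (H _)); lra.
  by rewrite S; lra.
Qed.

(** * Rational approximation and covering by blocks *)

(** Dirichlet's theorem by the pigeonhole principle, on the [Q + 1] fractional
    parts of [i * alpha] and [Q] boxes of length [1 / Q].  Dividing numerator and
    denominator by their gcd only improves the approximation. *)
Lemma dirichlet_approx (R : archiRealFieldType) (alpha : R) (Q : nat) :
  (0 < Q)%N ->
  exists q : nat, exists a : int,
    [/\ (0 < q <= Q)%N, coprimez a q & `|q%:R * alpha - a%:~R| <= Q%:R^-1].
Proof.
move=> Q0; have QR : 0 < Q%:R :> R by rewrite ltr0n.
suff [q [a [qQ near]]] : exists q : nat, exists a : int,
    (0 < q <= Q)%N /\ `|q%:R * alpha - a%:~R| <= Q%:R^-1.
  pose g := gcdn `|a| q.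
  have g0 : (0 < g)%N by rewrite gcdn_gt0; case/andP: qQ => ->; rewrite orbT.
  have /dvdnP[q' eq'] : (g %| q)%N by rewrite dvdn_gcdr.
  have /dvdzP[a' ea'] : (g%:Z %| a)%Z by rewrite dvdzE /= dvdn_gcdl.
  exists q', a'; split; first by nia.
    have : (gcdn `|a'| q' * g = g)%N.
      by rewrite muln_gcdl -eq' (_ : (`|a'| * g)%N = `|a|%N)// [in RHS]ea' abszM.
    rewrite coprimezE /coprime absz_nat => h; apply/eqP; nia.
  apply: le_trans near; rewrite eq' ea' intrM natrM.
  have -> : q'%:R * g%:R * alpha - a'%:~R * g%:~R = (q'%:R * alpha - a'%:~R) * g%:R.
    rewrite (_ : g%:Z%:~R = g%:R)//; ring.
  by rewrite normrM normr_nat ler_peMr// ler1n.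
pose fr (i : nat) : R := i%:R * alpha - (Num.floor (i%:R * alpha))%:~R.
have frP i : 0 <= fr i < 1.
  have := floor_itv (i%:R * alpha); rewrite intrD /fr => /andP[h1 h2].
  by apply/andP; split; lra.
have frQ i : (Num.truncn (Q%:R * fr i) < Q)%N.
  have /andP[h1 h2] := frP i.
  rewrite truncn_lt_nat; last by rewrite mulr_ge0// ltW.
  by rewrite -[ltRHS]mulr1 ltr_pM2l.
pose box (i : 'I_Q.+1) : 'I_Q := Ordinal (frQ i).
have [i [j [ij eb]]] : exists i j : 'I_Q.+1, (i < j)%N /\ box i = box j.
  have /injectivePn[i [j nij eb]] : ~~ injectiveb box.
    apply/injectiveP => /leq_card; rewrite !card_ord; lia.
  have : (i : nat) != j by exact: nij.
  by rewrite neq_ltn => /orP[h|h]; [exists i, j|exists j, i].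
exists (j - i)%N, (Num.floor (j%:R * alpha) - Num.floor (i%:R * alpha)).
split; first by have := ltn_ord j; lia.
have {eb} /(congr1 val)/= eb := eb.
have /andP[i1 i2] : (Num.truncn (Q%:R * fr i))%:R <= Q%:R * fr i
    < (Num.truncn (Q%:R * fr i)).+1%:R.
  by apply: truncn_itv; rewrite mulr_ge0//; case/andP: (frP i).
have /andP[j1 j2] : (Num.truncn (Q%:R * fr j))%:R <= Q%:R * fr j
    < (Num.truncn (Q%:R * fr j)).+1%:R.
  by apply: truncn_itv; rewrite mulr_ge0//; case/andP: (frP j).
rewrite -eb -natr1 in j1 j2; rewrite -natr1 in i2.
rewrite -(ler_pM2l QR) divff ?lt0r_neq0//.
rewrite -[X in X * `| _ |](gtr0_norm QR) -normrM natrB 1?ltnW// intrB.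
have -> : Q%:R * ((j%:R - i%:R) * alpha -
  ((Num.floor (j%:R * alpha))%:~R - (Num.floor (i%:R * alpha))%:~R)) =
  Q%:R * fr j - Q%:R * fr i by rewrite /fr; ring.
rewrite ler_norml; apply/andP; split; lra.
Qed.

(** Walk from [u] to [v]: skip a bad point at cost [1]; from any other point
    jump over a whole block at cost [B], that is, at most [B / r] for each point of
    the block.  The term [Q] pays for a last block that runs past [v]. *)
Lemma sum_le_blocks (R : realFieldType) (h : nat -> R) (bad : pred nat)
    (B r : R) (Q u v : nat) :
  0 <= B -> 0 < r -> (forall k, `|h k| <= 1) ->
  (forall k, (u <= k < v)%N -> ~~ bad k -> exists q : nat,
     [/\ (0 < q <= Q)%N, r <= q%:R & `|\sum_(j < q) h (k + j)%N| <= B]) ->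
  `|\sum_(u <= k < v) h k| <=
    B / r * (v - u)%:R + \sum_(u <= k < v) (bad k)%:R + Q%:R.
Proof.
move=> B0 r0 h1.
have [n] := ubnP (v - u)%N; elim: n u => // n IH u vu blk.
have Br0 : 0 <= B / r by rewrite divr_ge0// ltW.
have bad0 a b : 0 <= \sum_(a <= k < b) (bad k)%:R :> R by apply: sumr_ge0.
have [uv|uv] := leqP v u.
  by rewrite !big_geq// normr0 addr0 addr_ge0// mulr_ge0.
have trivial_bound (a b : nat) : (a <= b)%N -> `|\sum_(a <= k < b) h k| <= (b - a)%:R.
  move=> ab; apply: (le_trans (ler_norm_sum _ _ _)).
  apply: (@le_trans _ _ (\sum_(a <= k < b) 1)); first exact: ler_sum.
  by rewrite sumr_const_nat.
have [bu|gu] := boolP (bad u).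
  rewrite big_ltn// [X in _ <= _ + X + _]big_ltn// bu.
  apply: (le_trans (ler_normD _ _)).
  have := IH u.+1; rewrite (_ : _ < n)%N; last by lia.
  move=> /(_ isT) H.
  have {}H := H (fun k hk => blk k ltac:(lia)).
  have hu := h1 u.
  have : B / r * (v - u.+1)%:R <= B / r * (v - u)%:R.
    by rewrite ler_wpM2l// ler_nat; lia.
  move: H; rewrite /= mulr1n; lra.
have [q [/andP[q0 qQ] rq bq]] := blk u ltac:(lia) gu.
have [uqv|uqv] := leqP (u + q) v; last first.
  apply: (@le_trans _ _ Q%:R).
    apply: (le_trans (trivial_bound _ _ (ltnW uv))).
    by rewrite ler_nat; lia.
  by rewrite lerDr addr_ge0// mulr_ge0.
rewrite (@big_cat_nat _ _ _ (u + q)%N)//=; last by lia.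
rewrite [X in _ <= _ + X + _](@big_cat_nat _ _ _ (u + q)%N)//=; last by lia.
apply: (le_trans (ler_normD _ _)).
have e : \sum_(u <= k < u + q) h k = \sum_(j < q) h (u + j)%N.
  rewrite -{1}[u]add0n big_addn addKn big_mkord.
  by apply: eq_bigr => j _; rewrite addnC.
rewrite e.
have := IH (u + q)%N; rewrite (_ : _ < n)%N; last by lia.
move=> /(_ isT) H.
have {}H := H (fun k hk => blk k ltac:(lia)).
have -> : (v - u)%:R = (v - (u + q))%:R + q%:R :> R.
  by rewrite -natrD; congr (_%:R); lia.
have : B <= B / r * q%:R.
  by rewrite -mulrA ler_peMr// ler_pdivlMl// mulr1.
have := bad0 u (u + q)%N.
rewrite mulrDr; lra.
Qed.

(** The smallest and the largest element counted are at most [2 * w / lam] apart,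
    because [g] decreases by at least [lam] at each step. *)
Lemma count_separated (R : archiRealFieldType) (g : nat -> R) (P : pred nat) (u v : nat)
    (lam c w : R) :
  0 < lam -> 0 <= w ->
  (forall k l, (u <= k < l)%N -> (l < v)%N -> lam * (l - k)%:R <= g k - g l) ->
  (forall k, (u <= k < v)%N -> P k -> `|g k - c| <= w) ->
  \sum_(u <= k < v) (P k)%:R <= 1 + 2 * w / lam.
Proof.
move=> lam0 w0 sep near.
set L := 2 * w / lam.
have L0 : 0 <= L by rewrite divr_ge0// ?mulr_ge0// ltW.
suff H : (size [seq k <- index_iota u v | P k] <= (Num.truncn L).+1)%N.
  rewrite -natr_sum -big_mkcond /= sum1_count -size_filter.
  apply: (@le_trans _ _ (Num.truncn L).+1%:R); first by rewrite ler_nat.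
  by rewrite -natr1 addrC lerD2l truncn_le.
case E : [seq k <- index_iota u v | P k] => [|x s] //.
have srt : sorted ltn (x :: s).
  by rewrite -E sorted_filter ?iota_ltn_sorted//; exact: ltn_trans.
have mem k : k \in x :: s -> (u <= k < v)%N /\ P k.
  by rewrite -E mem_filter mem_index_iota => /andP[].
rewrite -(size_iota x (Num.truncn L).+1); apply: uniq_leq_size.
  by rewrite -E filter_uniq// iota_uniq.
move=> k ks; rewrite mem_iota.
have [xr Px] := mem x (mem_head _ _).
have [kr Pk] := mem k ks.
have xk : (x <= k)%N.
  move: ks; rewrite inE => /orP[/eqP->//|ks].
  by move: srt => /= /(order_path_min ltn_trans)/allP/(_ _ ks)/ltnW.
rewrite xk /=.
move: xk; rewrite leq_eqVlt => /orP[/eqP<-|xk]; first by lia.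
have s1 := sep x k ltac:(lia) ltac:(lia).
have := near x xr Px; have := near k kr Pk.
rewrite !ler_norml => /andP[a1 a2] /andP[b1 b2].
have : (k - x)%:R <= L.
  rewrite /L ler_pdivlMr// mulrC; lra.
by rewrite -truncn_ge_nat// addnS ltnS -leq_subLR.
Qed.

(** * The sawtooth along a hyperbola *)

(** The difference is exactly [X * j ^+ 2 / (t ^+ 2 * (t + j))]. *)
Lemma hyperbola_tangent (R : realFieldType) (X t j : R) :
  0 <= X -> 0 < t -> 0 <= j ->
  `|X / (t + j) - (X / t - X / t ^+ 2 * j)| <= X * j ^+ 2 / t ^+ 3.
Proof.
move=> X0 t0 j0.
have -> : X / (t + j) - (X / t - X / t ^+ 2 * j) = X * j ^+ 2 / (t ^+ 2 * (t + j)).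
  by field; apply/andP; split; lra.
rewrite ger0_norm.
  rewrite ler_wpM2l ?mulr_ge0 ?sqr_ge0//.
  rewrite lef_pV2 ?posrE ?exprn_gt0 ?mulr_gt0 ?exprn_gt0//; last by lra.
  by rewrite exprSr ler_pM2l ?exprn_gt0// lerDl.
by rewrite divr_ge0 ?mulr_ge0 ?sqr_ge0//; lra.
Qed.

Lemma inv_sqr_separated (R : realFieldType) (X t t' T : R) :
  0 <= X -> 0 < t -> t <= t' -> t' <= T ->
  2 * X / T ^+ 3 * (t' - t) <= X / t ^+ 2 - X / t' ^+ 2.
Proof.
move=> X0 t0 tt' t'T.
have t'0 : 0 < t' by lra.
have T0 : 0 < T by lra.
have -> : X / t ^+ 2 - X / t' ^+ 2 =
    X * ((t * t' ^+ 2)^-1 + (t ^+ 2 * t')^-1) * (t' - t).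
  by field; apply/andP; split; lra.
have -> : 2 * X / T ^+ 3 * (t' - t) = X * (2 / T ^+ 3) * (t' - t).
  by field; lra.
rewrite ler_wpM2r ?subr_ge0// ler_wpM2l//.
have H a : 0 < a -> a <= T ^+ 3 -> (T ^+ 3)^-1 <= a^-1.
  by move=> a0 aT; rewrite lef_pV2 ?posrE ?exprn_gt0.
have sq a : 0 < a -> a <= T -> a ^+ 2 <= T ^+ 2.
  by move=> a0 aT; rewrite ler_pXn2r// nnegrE ltW.
have tT : t <= T by lra.
have h1 : (T ^+ 3)^-1 <= (t * t' ^+ 2)^-1.
  apply: H; first by rewrite mulr_gt0 ?exprn_gt0.
  rewrite [T ^+ 3]exprS; apply: ler_pM => //; [exact: ltW|exact: sqr_ge0|exact: sq].
have h2 : (T ^+ 3)^-1 <= (t ^+ 2 * t')^-1.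
  apply: H; first by rewrite mulr_gt0 ?exprn_gt0.
  rewrite [T ^+ 3]exprSr; apply: ler_pM => //; [exact: sqr_ge0|exact: ltW|exact: sq].
lra.
Qed.

(** The points [k] with [n / 4 < k <= n].  The numerator of the hyperbola is
    written [z ^+ 6] and [s] stands for the square root of [n], which keeps all the
    fractional powers of the argument polynomial in [s] and [z].  [Q] is the largest
    order for which the deviation from the tangent over [q <= Q] steps is at most
    [1 / q].  A point is bad when its slope is close to a fraction whose denominator
    is at most [qmin]; [amax q] bounds the numerators that can occur. *)
Section HyperbolaBlock.
Variables (R : archiRealFieldType) (n : nat) (s z del : R).
Let X := z ^+ 6.
Let slope (k : nat) := X / (k%:R + del) ^+ 2.
Let Q := Num.truncn (n%:R / (4 * z ^+ 2)).
Let qmin := s / z.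
Let amax (q : nat) := Num.truncn (2 * q%:R * (16 * X / n%:R ^+ 2)).
Let hit (q k a : nat) := `|q%:R * slope k - a%:R| <= Q%:R^-1.
Let bad (k : nat) := has (fun q => has (hit q k) (index_iota 1 (amax q).+1))
  (index_iota 1 (Num.truncn qmin).+1).

Lemma block_numerator_gt0 : 1 < z -> 0 < X.
Proof. by move=> z1; rewrite exprn_gt0//; lra. Qed.

Lemma block_point_bounds k : (0 < n)%N -> 0 <= del <= 1 -> ((n %/ 4).+1 <= k < n.+1)%N ->
  n%:R / 4 <= k%:R + del /\ k%:R + del <= 2 * n%:R.
Proof.
move=> n0 /andP[d0 d1] /andP[k1 k2].
have nR : 1 <= n%:R :> R by rewrite ler1n.
have : n%:R <= 4 * k%:R :> R by rewrite -natrM ler_nat; lia.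
have : k%:R <= n%:R :> R by rewrite ler_nat; lia.
by split; lra.
Qed.

Lemma slope_bounds k : (0 < n)%N -> 1 < z -> 0 <= del <= 1 ->
  ((n %/ 4).+1 <= k < n.+1)%N ->
  X / (4 * n%:R ^+ 2) <= slope k /\ slope k <= 16 * X / n%:R ^+ 2.
Proof.
move=> n0 z1 del01 kr; have [t1 t2] := block_point_bounds n0 del01 kr.
have nR : 1 <= n%:R :> R by rewrite ler1n.
have X0 := block_numerator_gt0 z1.
have t0 : 0 < k%:R + del by lra.
split.
  have -> : 4 * n%:R ^+ 2 = (2 * n%:R) ^+ 2 :> R by ring.
  have T0 : 0 < 2 * n%:R :> R by lra.
  apply: ler_wpM2l; first exact: ltW.
  by rewrite lef_pV2 ?posrE ?exprn_gt0// lerXn2r ?nnegrE ?(ltW t0) ?(ltW T0).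
rewrite (_ : 16 * X / _ = X / (n%:R / 4) ^+ 2); last by field; lra.
rewrite ler_wpM2l ?(ltW X0)// lef_pV2 ?posrE ?exprn_gt0//; last by lra.
by rewrite ler_pXn2r ?nnegrE//; lra.
Qed.

(** Union bound over the fractions [a / q].  Each one is approached by at most
    [1 + 8 * n ^ 3 / (q * Q * X)] slopes, since consecutive slopes differ by at least
    [X / (4 * n ^ 3)]. *)
Lemma sum_bad_le :
  (0 < n)%N -> 0 < s -> 1 < z -> 0 <= del <= 1 -> (0 < Q)%N ->
  \sum_((n %/ 4).+1 <= k < n.+1) (bad k)%:R <=
    qmin * (2 * qmin * (16 * X / n%:R ^+ 2) + 256 * n%:R / Q%:R).
Proof.
move=> n0 s0 z1 del01 Q0; have X0 := block_numerator_gt0 z1.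
have nR : 1 <= n%:R :> R by rewrite ler1n.
have QR : 0 < Q%:R :> R by rewrite ltr0n.
have r0 : 0 < qmin by rewrite divr_gt0//; lra.
have cover : \sum_((n %/ 4).+1 <= k < n.+1) (bad k)%:R <=
    \sum_((n %/ 4).+1 <= k < n.+1)
      \sum_(1 <= q < (Num.truncn qmin).+1) \sum_(1 <= a < (amax q).+1)
        (hit q k a)%:R :> R.
  apply: ler_sum => k _.
  have [/hasP[q qr /hasP[a ar h]]|_] := boolP (bad k); last first.
    by apply: sumr_ge0 => q _; apply: sumr_ge0.
  rewrite (big_rem q)//= (big_rem a)//= h -addrA lerDl addr_ge0//.
    by apply: sumr_ge0.
  by apply: sumr_ge0 => ? _; apply: sumr_ge0.
apply: (le_trans cover); rewrite exchange_big /=.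
have Er : (Num.truncn qmin)%:R <= qmin by rewrite truncn_le ltW.
pose c := 2 * qmin * (16 * X / n%:R ^+ 2) + 256 * n%:R / Q%:R.
have G0 : 0 <= 16 * X / n%:R ^+ 2 by rewrite divr_ge0 ?sqr_ge0// mulr_ge0// ltW.
have c0 : 0 <= c.
  by apply: addr_ge0; [apply: mulr_ge0 => //; lra|apply: divr_ge0; lra].
apply: (@le_trans _ R (\sum_(1 <= q < (Num.truncn qmin).+1) c)); last first.
  by rewrite sumr_const_nat subn1 /= -[c *+ _]mulr_natl; exact: ler_wpM2r.
apply: ler_sum_nat => q /andP[q1 q2].
have qR : 1 <= q%:R :> R by rewrite ler1n.
have qr : q%:R <= qmin by apply: le_trans Er; rewrite ler_nat.
rewrite exchange_big /=.
pose e := 1 + 2 * (q%:R * Q%:R)^-1 / (X / (4 * n%:R ^+ 3)).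
apply: (@le_trans _ R (\sum_(1 <= a < (amax q).+1) e)).
  apply: ler_sum => a _.
  apply: (@count_separated _ slope _ _ _ _ (a%:R / q%:R)).
  - by rewrite divr_gt0// mulr_gt0// exprn_gt0//; lra.
  - by rewrite invr_ge0 mulr_ge0//; lra.
  - move=> k l /andP[uk kl] lv.
    have hk : ((n %/ 4).+1 <= k < n.+1)%N by rewrite uk (ltn_trans kl lv).
    have hl : ((n %/ 4).+1 <= l < n.+1)%N by rewrite (leq_trans uk (ltnW kl)) lv.
    have [t1 t2] := block_point_bounds n0 del01 hk.
    have [t1' t2'] := block_point_bounds n0 del01 hl.
    rewrite natrB ?(ltnW kl)//.
    have kl' : k%:R <= l%:R :> R by rewrite ler_nat ltnW.
    have := @inv_sqr_separated R X (k%:R + del) (l%:R + del) (2 * n%:R) (ltW X0).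
    rewrite -/(slope k) -/(slope l) => H; apply: (le_trans _ (H _ _ _)); [|lra|lra|lra].
    rewrite le_eqVlt; apply/orP; left; apply/eqP; field; lra.
  - move=> k _ h.
    rewrite (_ : slope k - _ = (q%:R * slope k - a%:R) / q%:R); last by field; lra.
    rewrite normrM normfV normr_nat ler_pdivrMr; last by lra.
    by apply: (le_trans h); rewrite invfM mulrAC mulVf ?mul1r//; lra.
have e0 : 0 <= e.
  apply: addr_ge0 => //; apply: divr_ge0.
    by rewrite mulr_ge0// invr_ge0 mulr_ge0.
  by rewrite divr_ge0 ?(ltW X0)// mulr_ge0// exprn_ge0.
rewrite sumr_const_nat subn1 /= -[e *+ _]mulr_natl.
have AR : (amax q)%:R <= 2 * q%:R * (16 * X / n%:R ^+ 2).
  by rewrite truncn_le mulr_ge0//; lra.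
apply: (le_trans (ler_wpM2r e0 AR)).
have -> : 2 * q%:R * (16 * X / n%:R ^+ 2) * e =
   2 * q%:R * (16 * X / n%:R ^+ 2) + 256 * n%:R / Q%:R.
  by rewrite /e; field; lra.
by rewrite lerD2r ler_wpM2r//; lra.
Qed.

(** Dirichlet's theorem supplies [a / q]; its numerator is positive because the
    slope exceeds [1 / Q], which is where [32 * n < z ^ 4] enters.  Were [q] below
    [qmin], the pair [(q, a)] would make [k] bad. *)
Lemma sum_sawtooth_good_block k :
  (0 < n)%N -> 0 < s -> 1 < z -> 32 * n%:R < z ^+ 4 -> 0 <= del <= 1 ->
  (0 < Q)%N -> 4 * z ^+ 2 * Q%:R <= n%:R -> n%:R < 8 * z ^+ 2 * Q%:R ->
  ((n %/ 4).+1 <= k < n.+1)%N -> ~~ bad k ->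
  exists q : nat, [/\ (0 < q <= Q)%N, qmin <= q%:R &
    `|\sum_(j < q) sawtooth (X / ((k + j)%:R + del))| <= 5].
Proof.
move=> n0 s0 z1 nz del01 Q0 Q1 Q2 kr gk; have X0 := block_numerator_gt0 z1.
have nR : 1 <= n%:R :> R by rewrite ler1n.
have QR : 1 <= Q%:R :> R by rewrite ler1n.
have r0 : 0 < qmin by rewrite divr_gt0//; lra.
have [g1 g2] := slope_bounds n0 z1 del01 kr.
have [t1 t2] := block_point_bounds n0 del01 kr.
have gQ : Q%:R^-1 < slope k.
  apply: lt_le_trans g1; rewrite -[Q%:R^-1]mul1r ltr_pdivrMr; last by lra.
  rewrite mulrAC ltr_pdivlMr; last by rewrite mulr_gt0// exprn_gt0//; lra.
  rewrite mul1r.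
  have : n%:R * (4 * n%:R) < n%:R * z ^+ 4 / 8.
    by rewrite -mulrA ltr_pM2l//; lra.
  have : n%:R * z ^+ 4 < 8 * z ^+ 2 * Q%:R * z ^+ 4.
    by rewrite ltr_pM2r// exprn_gt0//; lra.
  rewrite /X (_ : z ^+ 6 = z ^+ 2 * z ^+ 4); [lra|ring].
have [q [a [/andP[q0 qQ] cop near]]] := dirichlet_approx (slope k) Q0.
have qR : 1 <= q%:R :> R by rewrite ler1n.
have qg : slope k <= q%:R * slope k by rewrite ler_peMl//; have := invr_ge0 Q%:R; lra.
move: (near); rewrite ler_norml => /andP[a1 a2].
have a0 : 0 < a by rewrite -(ltr_int R); lra.
exists q; split; first by rewrite q0.
- rewrite leNgt; apply/negP => qr; move/negP: gk; apply.
  apply/hasP; exists q.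
    by rewrite mem_index_iota q0 /= ltnS truncn_ge_nat ?ltW.
  have aE : (`|a|%N%:R = a%:~R :> R).
    by rewrite -[in RHS](gtz0_abs a0).
  apply/hasP; exists `|a|%N; last by rewrite /hit aE.
  rewrite mem_index_iota ltnS absz_gt0 gt_eqF //=.
  rewrite truncn_ge_nat; last first.
    apply: mulr_ge0; first by rewrite mulr_ge0.
    by apply: le_trans g2; apply: ltW; apply: lt_trans gQ; rewrite invr_gt0; lra.
  rewrite aE.
  have : q%:R * slope k <= q%:R * (16 * X / n%:R ^+ 2) by rewrite ler_wpM2l.
  rewrite -mulrA; lra.
- have := @sum_sawtooth_near_progression R q (- a) (X / (k%:R + del)) 2
    (fun j => X / ((k + j)%:R + del)) q0.
  rewrite /coprimez gcdNz => /(_ cop) H.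
  have {}H : `|\sum_(j < q) sawtooth (X / ((k + j)%:R + del))| <= 2 * 2 + 2^-1;
    last by lra.
  apply: H => j jq.
  have jR : j%:R <= q%:R :> R by rewrite ler_nat ltnW.
  have t0 : 0 < k%:R + del by lra.
  have T := @hyperbola_tangent R X (k%:R + del) j%:R (ltW X0) t0 (ler0n _ _).
  rewrite natrD (_ : k%:R + j%:R + del = k%:R + del + j%:R); last by ring.
  set y := X / _ in T *; set y0 := X / (k%:R + del) in T *.
  rewrite -/(slope k) in T.
  have -> : y - (y0 + (- a)%:~R * j%:R / q%:R) =
      (y - (y0 - slope k * j%:R)) - (q%:R * slope k - a%:~R) * (j%:R / q%:R).
    rewrite intrN; field; lra.
  apply: (le_trans (ler_normB _ _)).
  have qV : 0 < q%:R^-1 :> R by rewrite invr_gt0; lra.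
  have h1 : X * j%:R ^+ 2 / (k%:R + del) ^+ 3 <= q%:R^-1.
    rewrite ler_pdivrMr ?exprn_gt0// ler_pdivlMl; last by lra.
    have qq : q%:R <= Q%:R :> R by rewrite ler_nat.
    have c1 : (z ^+ 2 * Q%:R) ^+ 3 <= (k%:R + del) ^+ 3.
      rewrite ler_pXn2r// ?nnegrE; [lra| |lra].
      by rewrite mulr_ge0 ?sqr_ge0.
    apply: le_trans c1.
    have -> : q%:R * (X * j%:R ^+ 2) = X * (q%:R * j%:R ^+ 2) by ring.
    have -> : (z ^+ 2 * Q%:R) ^+ 3 = X * (Q%:R * Q%:R ^+ 2) by rewrite /X; ring.
    rewrite ler_wpM2l ?(ltW X0)// ler_pM ?sqr_ge0//.
    by rewrite ler_pXn2r ?nnegrE//; lra.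
  have h2 : `|(q%:R * slope k - a%:~R) * (j%:R / q%:R)| <= q%:R^-1.
    rewrite normrM (ger0_norm (_ : 0 <= j%:R / q%:R)); last by rewrite divr_ge0.
    rewrite -[leRHS]mulr1; apply: ler_pM;
      [exact: normr_ge0|by rewrite divr_ge0| |by rewrite ler_pdivrMr ?mul1r//; lra].
    by apply: (le_trans near); rewrite lef_pV2 ?posrE ?ler_nat//; lra.
  by lra.
Qed.

(** For [n < 4 * z ^ 2] the trivial bound [n = s ^ 2 < 2 * s * z] suffices.
    Otherwise [Q] has the exact order [n / z ^ 2], and each of the terms of
    [sum_le_blocks] is at most a constant times [s * z]; the choice
    [qmin = s / z] balances the good blocks against the bad points. *)
Lemma sum_sawtooth_block :
  (0 < n)%N -> 0 < s -> s ^+ 2 = n%:R -> 1 < z -> 32 * n%:R < z ^+ 4 -> 0 <= del <= 1 ->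
  `|\sum_((n %/ 4).+1 <= k < n.+1) sawtooth (X / (k%:R + del))| <= 2060 * s * z.
Proof.
move=> n0 s0 sn z1 nz del01; have X0 := block_numerator_gt0 z1.
have nR : 1 <= n%:R :> R by rewrite ler1n.
have sz0 : 0 < s * z by rewrite mulr_gt0//; lra.
have s2 : (n - n %/ 4)%:R <= s ^+ 2 by rewrite sn ler_nat leq_subr.
have zz : 0 < z ^+ 2 by rewrite exprn_gt0//; lra.
have [small|large] := ltP n%:R (4 * z ^+ 2).
  have sz : s < 2 * z.
    rewrite -(@ltr_pXn2r _ 2) ?nnegrE//; [|lra|lra].
    by rewrite sn (_ : (2 * z) ^+ 2 = 4 * z ^+ 2)//; ring.
  apply: (le_trans (ler_norm_sum _ _ _)).
  apply: (@le_trans _ _ (\sum_((n %/ 4).+1 <= k < n.+1) 1)).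
    by apply: ler_sum => *; exact: norm_sawtooth.
  rewrite sumr_const_nat subSS; apply: (le_trans s2).
  have : s * s <= s * (2 * z) by rewrite ler_wpM2l ?ltW.
  rewrite expr2; lra.
have q1 : 1 <= n%:R / (4 * z ^+ 2) by rewrite ler_pdivlMr ?mul1r//; lra.
have Q0 : (0 < Q)%N by rewrite truncn_gt0.
have QR : 1 <= Q%:R :> R by rewrite ler1n.
have /andP[Q1 Q2] : Q%:R <= n%:R / (4 * z ^+ 2) < Q.+1%:R by apply: truncn_itv; lra.
have {}Q1 : 4 * z ^+ 2 * Q%:R <= n%:R.
  by move: Q1; rewrite ler_pdivlMr; [lra|lra].
have {}Q2 : n%:R < 8 * z ^+ 2 * Q%:R.
  move: Q2; rewrite ltr_pdivrMr; last by lra.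
  move=> /lt_le_trans; apply; rewrite -natr1.
  have : z ^+ 2 * 1 <= z ^+ 2 * Q%:R by rewrite ler_pM2l.
  lra.
have r0 : 0 < qmin by rewrite divr_gt0//; lra.
have := @sum_le_blocks R (fun k => sawtooth (X / (k%:R + del))) bad 5 qmin Q
   (n %/ 4).+1 n.+1 ltac:(lra) r0 (fun k => norm_sawtooth _).
have good k := @sum_sawtooth_good_block k n0 s0 z1 nz del01 Q0 Q1 Q2.
move=> /(_ good)/le_trans; apply.
rewrite subSS.
have b := sum_bad_le n0 s0 z1 del01 Q0.
have e1 : 5 / qmin * (n - n %/ 4)%:R <= 5 * s * z.
  apply: (@le_trans _ _ (5 / qmin * s ^+ 2)).
    by rewrite ler_wpM2l// divr_ge0// ltW.
  by rewrite le_eqVlt; apply/orP; left; apply/eqP; rewrite /qmin; field; lra.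
have e2 : qmin * (2 * qmin * (16 * X / n%:R ^+ 2)) <= 4 * s * z.
  have -> : qmin * (2 * qmin * (16 * X / n%:R ^+ 2)) = 32 * (z / s) ^+ 3 * (s * z).
    by rewrite /qmin /X -sn; field; lra.
  have : (z / s) <= 2^-1.
    rewrite ler_pdivrMr//.
    rewrite -(@ler_pXn2r _ 2) ?nnegrE//; [|lra|lra].
    by rewrite exprMn sn; lra.
  move=> h; have : (z / s) ^+ 3 <= 2^-1 ^+ 3.
    by apply: lerXn2r; rewrite ?nnegrE ?divr_ge0 ?invr_ge0 ?(ltW s0)//; lra.
  rewrite (_ : 2^-1 ^+ 3 = 8^-1); last by field.
  move=> h3; have := ler_wpM2r (ltW sz0) h3; lra.
have e3 : qmin * (256 * n%:R / Q%:R) <= 2048 * s * z.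
  have -> : qmin * (256 * n%:R / Q%:R) = 256 * qmin / Q%:R * n%:R by ring.
  apply: (@le_trans _ _ (256 * qmin / Q%:R * (8 * z ^+ 2 * Q%:R))).
    apply: ler_wpM2l; last exact: ltW.
    by apply: divr_ge0; [apply: mulr_ge0; [exact: ler0n|exact: ltW]|exact: ler0n].
  by rewrite le_eqVlt; apply/orP; left; apply/eqP; rewrite /qmin; field; lra.
have e4 : Q%:R <= s * z.
  have sz3 : s <= z ^+ 3.
    rewrite -(@ler_pXn2r _ 2) ?nnegrE// ?exprn_ge0//; [|lra|lra].
    rewrite sn -exprM.
    have : z ^+ 4 <= z ^+ (3 * 2) by apply: ler_weXn2l => //; lra.
    lra.
  rewrite -(ler_pM2l zz).
  apply: (@le_trans _ _ n%:R); first by lra.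
  rewrite -sn expr2 (_ : z ^+ 2 * _ = s * z ^+ 3); last by ring.
  by rewrite ler_pM2l.
have := b; rewrite mulrDr; lra.
Qed.

End HyperbolaBlock.

(** Cut at [n / 4]: the square root halves, so the bounds for the successive
    pieces form a geometric progression of ratio [1/2] and no logarithm is lost. *)
Lemma sum_sawtooth_hyperbola (R : realType) (n : nat) (z del : R) :
  0 < z -> 32 * n%:R < z ^+ 4 -> 0 <= del <= 1 ->
  `|\sum_(1 <= k < n.+1) sawtooth (z ^+ 6 / (k%:R + del))| <= 4120 * Num.sqrt n%:R * z.
Proof.
move=> z0 + del01.
elim/ltn_ind: n => n IH nz.
have [->|n0] := posnP n; first by rewrite big_geq// normr0 sqrtr0 mulr0 mul0r.
have nR : 1 <= n%:R :> R by rewrite ler1n.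
set s : R := Num.sqrt n%:R.
have s0 : 0 < s by rewrite sqrtr_gt0; lra.
have sn : s ^+ 2 = n%:R by rewrite sqr_sqrtr.
have z1 : 1 < z.
  rewrite ltNge; apply/negP => zle.
  by have := exprn_ile1 4 (ltW z0) zle; lra.
have n4 : 4 * (n %/ 4)%:R <= n%:R :> R.
  by rewrite -natrM ler_nat mulnC leq_divM.
rewrite (@big_cat_nat _ _ _ (n %/ 4).+1)//=; last by rewrite ltnS leq_div.
apply: (le_trans (ler_normD _ _)).
have h1 := IH (n %/ 4)%N (ltn_Pdiv (isT : (1 < 4)%N) n0) ltac:(lra).
have h2 := sum_sawtooth_block n0 s0 sn z1 nz del01.
have h3 : Num.sqrt (n %/ 4)%:R <= s / 2.
  rewrite -[leRHS]gtr0_norm; last by lra.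
  rewrite -sqrtr_sqr; apply: ler_wsqrtr.
  rewrite expr_div_n sn; lra.
have h4 := ler_wpM2r (ltW z0) h3; lra.
Qed.

(** * Squarefree indicator as a divisor sum *)

Lemma squarefree_mul_prime (p d : nat) :
  prime p -> ~~ (p %| d)%N -> squarefree (p * d) = squarefree d.
Proof.
move=> pp npd; apply/squarefreeP/squarefreeP => -[d0 H].
  split=> [|e ed]; first by case: (posnP d) d0 => // ->; rewrite muln0.
  by apply: H; apply: dvdn_mull.
split=> [|e ed]; first by rewrite muln_gt0 prime_gt0.
have [pe|npe] := boolP (p %| e)%N.
  case/negP: npd.
  have : (p * p %| p * d)%N.
    by apply: dvdn_trans ed; rewrite -mulnn dvdn_mul.
  by rewrite dvdn_pmul2l// prime_gt0.
apply: H; move: ed; rewrite Gauss_dvdr//.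
by rewrite coprimeXl// coprime_sym prime_coprime.
Qed.

Lemma moebius_mul_prime (p d : nat) :
  prime p -> ~~ (p %| d)%N -> moebius (p * d) = - moebius d.
Proof.
move=> pp npd; have d0 : (0 < d)%N by case: d npd => //; rewrite dvdn0.
rewrite /moebius squarefree_mul_prime//; case: ifP => _; last by rewrite oppr0.
have : perm_eq (primes (p * d)) (p :: primes d).
  apply: uniq_perm; rewrite ?primes_uniq//=.
    by rewrite primes_uniq mem_primes (negPf npd) !andbF.
  move=> q; rewrite primesM// ?prime_gt0// primes_prime// !inE.
  by [].
by move/perm_size => ->; rewrite /= exprS mulN1r.
Qed.

Lemma squarefree_dvd (d e : nat) : (e %| d)%N -> squarefree d -> squarefree e.
Proof.
move=> ed /squarefreeP[d0 H]; apply/squarefreeP; split; first exact: dvdn_gt0 ed.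
by move=> k ke; apply: H; apply: dvdn_trans ed.
Qed.

(** If [p ^ 2] divides [m] for a prime [p], then exchanging [d] and [p * d], for
    [d] prime to [p], is an involution of the squarefree [d] with [d ^ 2 %| m] that
    changes the sign of [moebius d]. *)
Lemma sum_moebius_sqr_dvd (M m : nat) : (0 < m <= M)%N ->
  \sum_(1 <= d < M.+1 | (d ^ 2 %| m)%N) moebius d = mu2 m.
Proof.
move=> /andP[m0 mM]; rewrite mu2E.
have [sf|nsf] := boolP (squarefree m).
  rewrite big_ltn_cond; last by lia.
  rewrite exp1n dvd1n big_nat_cond big_pred0 ?addr0; first by [].
  move=> d; apply/negP => /andP[/andP[d2 _] dm].
  by case/squarefreeP: sf => _ /(_ d dm) d1; rewrite d1 in d2.
have [p pp p2] : exists2 p, prime p & (p ^ 2 %| m)%N.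
  move: nsf; rewrite /squarefree m0 /= -has_predC => /hasP[p].
  by rewrite mem_primes => /and3P[pp _ _] /=; rewrite negbK => ?; exists p.
have p1 := prime_gt1 pp.
have -> : \sum_(1 <= d < M.+1 | (d ^ 2 %| m)%N) moebius d =
    \sum_(0 <= d < M.+1 | (d ^ 2 %| m)%N) moebius d.
  by rewrite [RHS]big_ltn_cond// exp0n// dvd0n gtn_eqF.
rewrite big_mkord.
have -> : \sum_(d < M.+1 | (d ^ 2 %| m)%N) moebius d =
    \sum_(d < M.+1 | (d ^ 2 %| m)%N && squarefree d) moebius d.
  rewrite [LHS]big_mkcond [RHS]big_mkcond /=; apply: eq_bigr => d _.
  by rewrite /moebius; case: (_ %| _)%N; case: squarefree.
set P := fun d : 'I_M.+1 => (d ^ 2 %| m)%N && squarefree d.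
pose tog (d : nat) := if (p %| d)%N then (d %/ p)%N else (p * d)%N.
have togP (d : 'I_M.+1) : P d -> [/\ (tog d < M.+1)%N, (tog d ^ 2 %| m)%N,
    squarefree (tog d), tog (tog d) = d & moebius (tog d) = - moebius d].
  move=> /andP[dm sf]; have [d0 sfd] := squarefreeP _ sf.
  have dM := ltn_ord d.
  rewrite /tog; have [/dvdnP[e de]|npd] := boolP (p %| d)%N.
    have e0 : (0 < e)%N by lia.
    have npe : ~~ (p %| e)%N.
      apply/negP => /dvdnP[k ek].
      have := sfd p; rewrite de ek -mulnA mulnn dvdn_mull// => /(_ isT) h.
      by rewrite h in p1.
    have ed : (e %| d)%N by rewrite de dvdn_mulr.
    rewrite de mulnK ?(prime_gt0 pp)// (negPf npe) mulnC; split=> //.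
    - exact: leq_ltn_trans (dvdn_leq d0 ed) dM.
    - by apply: dvdn_trans dm; rewrite dvdn_exp2r.
    - exact: squarefree_dvd ed sf.
    - by rewrite [(e * p)%N]mulnC moebius_mul_prime// opprK.
  have pdm : ((p * d) ^ 2 %| m)%N.
    rewrite expnMn Gauss_dvd ?p2 ?dm//.
    by rewrite coprimeXl// coprimeXr// prime_coprime.
  rewrite dvdn_mulr// mulKn ?(prime_gt0 pp)//; split=> //.
  - rewrite ltnS; apply: leq_trans mM; apply: leq_trans (dvdn_leq m0 pdm).
    by rewrite -mulnn leq_pmulr// muln_gt0 prime_gt0.
  - by rewrite squarefree_mul_prime.
  - exact: moebius_mul_prime.
pose h (d : 'I_M.+1) : 'I_M.+1 := inord (tog d).
have hE d : P d -> h d = tog d :> nat.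
  by move=> /togP[lt _ _ _ _]; rewrite inordK.
have Ph d : P d -> P (h d).
  by move=> Pd; rewrite /P hE//; have [_ -> ->] := togP d Pd.
have hh d : P d -> h (h d) = d.
  move=> Pd; apply: val_inj; rewrite /= hE ?Ph// hE//.
  by have [] := togP d Pd.
have S : \sum_(d | P d) moebius d = - \sum_(d | P d) moebius d.
  rewrite {1}(reindex_onto h h hh) -sumrN.
  apply: eq_big => [d|d].
    apply/idP/idP => [/andP[/Ph hP /eqP e]|Pd]; first by rewrite e in hP.
    by rewrite Ph// hh//=.
  move=> /andP[/Ph Phh /eqP e]; rewrite e in Phh.
  by rewrite hE//; have [] := togP d Phh.
by move: S; rewrite /P /=; lia.
Qed.

(** * Summation over the values of the quotient *)

Lemma sum_multiples (V : nmodType) (F : nat -> V) (D M : nat) : (0 < D)%N ->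
  \sum_(1 <= m < M.+1 | (D %| m)%N) F m = \sum_(1 <= k < (M %/ D).+1) F (D * k)%N.
Proof.
move=> D0; elim: M => [|M IH]; first by rewrite div0n !big_geq.
rewrite big_mkcond big_nat_recr//= -big_mkcond /= IH divnS//.
case: ifP => [/dvdnP[k ek]|_]; last by rewrite addr0.
rewrite add1n [RHS]big_nat_recr//=; congr (_ + F _).
rewrite ek mulnC; congr (_ * _)%N.
have := divnS M D0; rewrite ek mulnK// dvdn_mull//; lia.
Qed.

(** With [a] and [b] the cube roots of [n] and [n + 1], the telescoping bound
    [b ^- 4 <= 3 / a - 3 / b] follows from [b ^ 3 - a ^ 3 = 1]. *)
Lemma sum_inv_mul_cbrt (R : realType) (N : nat) :
  \sum_(1 <= d < N.+1) (d%:R * d%:R `^ 3^-1)^-1 <= 4 :> R.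
Proof.
case: N => [|N]; first by rewrite big_geq.
suff H : \sum_(1 <= d < N.+2) (d%:R * d%:R `^ 3^-1)^-1 <=
    4 - 3 / N.+1%:R `^ 3^-1 :> R.
  by apply: (le_trans H); rewrite lerBlDr lerDl divr_ge0// powR_ge0.
elim: N => [|N IH]; first by rewrite big_nat1 powR1 mulr1; lra.
rewrite big_nat_recr//=; apply: (le_trans (lerD IH (lexx _))).
have cube n : (n.+1%:R `^ 3^-1) ^+ 3 = n.+1%:R :> R.
  by rewrite -powR_mulrn ?powR_ge0// -powRrM mulVf// powRr1.
have a0 : 0 < N.+1%:R `^ 3^-1 :> R by rewrite powR_gt0.
have b0 : 0 < N.+2%:R `^ 3^-1 :> R by rewrite powR_gt0.
have := cube N.+1; have := cube N.
move: a0 b0; set a := N.+1%:R `^ _; set b := N.+2%:R `^ _ => a0 b0 ea eb.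
have ba3 : b ^+ 3 = a ^+ 3 + 1 by rewrite ea eb natr1.
rewrite -eb.
have ab : a <= b.
  by rewrite -(@ler_pXn2r _ 3) ?nnegrE ?(ltW a0) ?(ltW b0)// ba3 lerDl.
have e1 : (b - a) * (b ^+ 2 + a * b + a ^+ 2) = 1.
  by rewrite (_ : _ * _ = b ^+ 3 - a ^+ 3); [lra|ring].
suff : (b ^+ 3 * b)^-1 <= 3 * (b - a) / (a * b).
  have -> : 3 * (b - a) / (a * b) = 3 / a - 3 / b by field; lra.
  lra.
rewrite ler_pdivlMr ?mulr_gt0// -ler_pdivlMl ?invr_gt0 ?mulr_gt0 ?exprn_gt0//.
rewrite invrK.
have ba : 0 <= b - a by lra.
have h1 : a * b + a ^+ 2 <= 2 * b ^+ 2.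
  have := ler_pM (ltW a0) (ltW a0) ab ab.
  have := ler_wpM2r (ltW b0) ab; rewrite !expr2; lra.
have h2 : 1 <= (b - a) * (3 * b ^+ 2).
  rewrite -[leLHS]e1 ler_wpM2l//; lra.
have h3 : a * b * 1 <= a * b * ((b - a) * (3 * b ^+ 2)).
  by rewrite ler_wpM2l// mulr_ge0 ?(ltW a0) ?(ltW b0).
have h4 : a * b * ((b - a) * (3 * b ^+ 2)) <= b ^+ 3 * b * (3 * (b - a)).
  have -> : a * b * ((b - a) * (3 * b ^+ 2)) = a * (b ^+ 3 * (3 * (b - a))) by ring.
  have -> : b ^+ 3 * b * (3 * (b - a)) = b * (b ^+ 3 * (3 * (b - a))) by ring.
  rewrite ler_wpM2r// mulr_ge0 ?exprn_ge0 ?(ltW b0)//; lra.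
lra.
Qed.

Lemma norm_moebius (R : realDomainType) (d : nat) : `|(moebius d)%:~R| <= 1 :> R.
Proof.
rewrite /moebius; case: ifP => _; last by rewrite normr0.
by rewrite rmorphXn /= rmorphN1 normrX normrN1 expr1n.
Qed.

(** Here [x = y ^ 18], so that [x ^ (4/9)] and the cutoff [x ^ (5/9)] are the
    integral powers [y ^ 8] and [y ^ 10].  The [d]-th inner sum has numerator
    [x / d ^ 2 = (y ^ 3 / c) ^ 6], [c] being the cube root of [d], and shift
    [delta / d ^ 2]. *)
Lemma sum_mu2_sawtooth (R : realType) (M : nat) (y del : R) :
  0 < y -> 32 < y ^+ 2 -> M%:R <= y ^+ 10 -> 0 <= del <= 1 ->
  `|\sum_(1 <= m < M.+1) (mu2 m)%:~R * sawtooth (y ^+ 18 / (m%:R + del))| <=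
    4 * 4120 * y ^+ 8.
Proof.
move=> y0 y32 My /andP[d0 d1].
pose F (m : nat) : R := sawtooth (y ^+ 18 / (m%:R + del)).
have -> : \sum_(1 <= m < M.+1) (mu2 m)%:~R * sawtooth (y ^+ 18 / (m%:R + del)) =
   \sum_(1 <= d < M.+1) (moebius d)%:~R *
      \sum_(1 <= k < (M %/ d ^ 2).+1) F (d ^ 2 * k)%N.
  transitivity (\sum_(1 <= m < M.+1) \sum_(1 <= d < M.+1 | (d ^ 2 %| m)%N)
      (moebius d)%:~R * F m).
    apply: eq_big_nat => m mM.
    by rewrite -(@sum_moebius_sqr_dvd M)// rmorph_sum mulr_suml.
  rewrite (exchange_big_dep_nat xpredT)//=.
  apply: eq_big_nat => d /andP[d1' _].
  by rewrite -mulr_sumr sum_multiples// expn_gt0 d1'.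
apply: (le_trans (ler_norm_sum _ _ _)).
apply: (@le_trans _ _ (\sum_(1 <= d < M.+1)
  4120 * y ^+ 8 * (d%:R * d%:R `^ 3^-1)^-1)); last first.
  rewrite -mulr_sumr.
  have := ler_wpM2l (mulr_ge0 (ler0n R 4120) (exprn_ge0 8 (ltW y0)))
    (sum_inv_mul_cbrt R M).
  lra.
apply: ler_sum_nat => d /andP[dgt0 _].
have dR : 1 <= d%:R :> R by rewrite ler1n.
rewrite normrM -[leRHS]mul1r; apply: ler_pM => //; first exact: norm_moebius.
set c : R := d%:R `^ 3^-1.
have c3 : c ^+ 3 = d%:R.
  by rewrite /c -powR_mulrn ?powR_ge0// -powRrM mulVf// powRr1.
have c0 : 0 < c by rewrite powR_gt0; lra.
have cd : c <= d%:R.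
  by rewrite -[leRHS]powRr1//; apply: ler_powR => //; lra.
have d2 : 0 < d%:R ^+ 2 :> R by rewrite exprn_gt0; lra.
have nM : (M %/ d ^ 2)%:R <= (y ^+ 5 / d%:R) ^+ 2.
  rewrite expr_div_n -exprM ler_pdivlMr//; apply: le_trans My.
  by rewrite -natrX -natrM ler_nat leq_divM.
have -> : \sum_(1 <= k < (M %/ d ^ 2).+1) F (d ^ 2 * k)%N =
   \sum_(1 <= k < (M %/ d ^ 2).+1)
     sawtooth ((y ^+ 3 / c) ^+ 6 / (k%:R + del / d%:R ^+ 2)).
  apply: eq_big_nat => k /andP[k1 _]; rewrite /F; congr sawtooth.
  have kR : 1 <= k%:R :> R by rewrite ler1n.
  rewrite natrM natrX.
  have -> : (y ^+ 3 / c) ^+ 6 = y ^+ 18 / d%:R ^+ 2.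
    by rewrite expr_div_n -exprM -c3 -exprM.
  have dk : 0 < d%:R ^+ 2 * k%:R :> R by rewrite mulr_gt0//; lra.
  field; apply/andP; split; lra.
apply: (le_trans
  (@sum_sawtooth_hyperbola R (M %/ d ^ 2) (y ^+ 3 / c) (del / d%:R ^+ 2) _ _ _)).
- by rewrite divr_gt0// exprn_gt0.
- apply: (@le_lt_trans _ _ (32 * (y ^+ 5 / d%:R) ^+ 2)); first by lra.
  have -> : (y ^+ 3 / c) ^+ 4 = y ^+ 12 / (d%:R * c).
    by rewrite expr_div_n -exprM -c3 -exprSr.
  have -> : 32 * (y ^+ 5 / d%:R) ^+ 2 = 32 * (y ^+ 10 / d%:R ^+ 2) by field; lra.
  rewrite ltr_pdivlMr; last by rewrite mulr_gt0//; lra.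
  have -> : 32 * (y ^+ 10 / d%:R ^+ 2) * (d%:R * c) = 32 * y ^+ 10 * (c / d%:R).
    by field; lra.
  apply: (@le_lt_trans _ _ (32 * y ^+ 10)).
    rewrite ler_piMr ?mulr_ge0 ?exprn_ge0 ?(ltW y0)//.
    by rewrite ler_pdivrMr ?mul1r//; lra.
  by rewrite (_ : y ^+ 12 = y ^+ 2 * y ^+ 10); [rewrite ltr_pM2r// exprn_gt0|ring].
- rewrite divr_ge0 ?(ltW d2)//= ler_pdivrMr// mul1r.
  by apply: (le_trans d1); rewrite exprn_ege1.
have sq : Num.sqrt (M %/ d ^ 2)%:R <= y ^+ 5 / d%:R.
  rewrite -[leRHS]ger0_norm; last by rewrite divr_ge0// exprn_ge0// ltW.
  by rewrite -sqrtr_sqr; exact: ler_wsqrtr.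
have -> : 4120 * y ^+ 8 / (d%:R * c) = 4120 * (y ^+ 5 / d%:R) * (y ^+ 3 / c).
  by field; lra.
have zc0 : 0 <= y ^+ 3 / c by rewrite divr_ge0 ?exprn_ge0 ?(ltW y0) ?(ltW c0).
by apply: ler_wpM2r; [exact: zc0|apply: ler_wpM2l; [exact: ler0n|exact: sq]].
Qed.

Lemma sum_geq_minn (K T : nat) : (\sum_(1 <= n < T.+1) (n <= K))%N = minn K T.
Proof.
elim: T => [|T IH]; first by rewrite big_geq ?minn0.
by rewrite big_nat_recr//= IH; case: leqP; lia.
Qed.

(** Both [m <= floor (x / n)] and [n <= floor (x / m)] mean [m * n <= x]. *)
Lemma sum_le_truncn_div (R : archiRealFieldType) (x : R) (m : nat) :
  0 <= x -> (0 < m)%N ->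
  (\sum_(1 <= n < (Num.truncn x).+1) (m <= Num.truncn (x / n%:R)))%N =
    Num.truncn (x / m%:R).
Proof.
move=> x0 m0; have mR : 1 <= m%:R :> R by rewrite ler1n.
have le_m : (Num.truncn (x / m%:R) <= Num.truncn x)%N.
  by apply: le_truncn; rewrite ler_pdivrMr ?ler_peMr//; lra.
rewrite -[RHS](minn_idPl le_m) -sum_geq_minn; apply: eq_big_nat => n /andP[n0 _].
have nR : 0 < n%:R :> R by rewrite ltr0n.
congr (nat_of_bool _); rewrite !truncn_ge_nat ?divr_ge0//.
by rewrite !ler_pdivlMr// 1?mulrC//; lra.
Qed.

(** By [sum_le_truncn_div], the value [m] is taken exactly
    [floor (x / m) - floor (x / (m + 1))] times, and values above [M] are taken
    [floor (x / (M + 1))] times. *)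
Lemma sum_truncn_div (R : archiRealFieldType) (f : nat -> R) (x : R) (M : nat) :
  0 <= x -> (forall m, 0 <= f m <= 1) ->
  `|\sum_(1 <= n < (Num.truncn x).+1) f (Num.truncn (x / n%:R)) -
    \sum_(1 <= m < M.+1)
      f m * ((Num.truncn (x / m%:R))%:R - (Num.truncn (x / m.+1%:R))%:R)| <=
    x / M.+1%:R.
Proof.
move=> x0 f01.
pose t (n : nat) := Num.truncn (x / n%:R).
have cnt m : (0 < m)%N ->
    (t m)%:R = \sum_(1 <= n < (Num.truncn x).+1) (m <= t n)%N%:R :> R.
  by move=> m0; rewrite /t -sum_le_truncn_div// natr_sum.
have -> : \sum_(1 <= m < M.+1) f m * ((t m)%:R - (t m.+1)%:R) =
    \sum_(1 <= n < (Num.truncn x).+1) (if (t n <= M)%N then f (t n) else 0).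
  transitivity (\sum_(1 <= m < M.+1) \sum_(1 <= n < (Num.truncn x).+1)
      f m * (m == t n)%:R).
    apply: eq_big_nat => m /andP[m0 _]; rewrite !cnt// -sumrB mulr_sumr.
    apply: eq_bigr => n _; congr (_ * _).
    by case: (ltngtP m (t n)) => _; rewrite ?subrr ?subr0.
  rewrite exchange_big_nat /=; apply: eq_big_nat => n /andP[n0 nx].
  have nR : 0 < n%:R :> R by rewrite ltr0n.
  have t0 : (0 < t n)%N.
    rewrite truncn_gt0 ler_pdivlMr// mul1r.
    by rewrite -truncn_ge_nat.
  case: ifP => tM.
    rewrite (big_rem (t n)) /=; last by rewrite mem_index_iota t0 ltnS.
    rewrite eqxx mulr1 big1_seq ?addr0// => m /andP[_].
    rewrite mem_rem_uniq ?iota_uniq// inE => /andP[/negPf-> _].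
    by rewrite mulr0.
  rewrite big1_seq// => m /andP[_]; rewrite mem_index_iota => /andP[_ mM].
  by case: eqP => [e|]; rewrite ?mulr0//; move: tM; rewrite -e -ltnS mM.
rewrite -sumrB.
apply: (@le_trans _ _ (t M.+1)%:R); last by rewrite truncn_le divr_ge0.
rewrite cnt//; apply: (le_trans (ler_norm_sum _ _ _)); apply: ler_sum => n _.
have /andP[f0 f1] := f01 (t n).
by rewrite -/(t n); case: leqP => _; rewrite ?subrr ?normr0// subr0 ger0_norm.
Qed.

Lemma sawtooth_truncn (R : archiRealFieldType) (u : R) :
  0 <= u -> (Num.truncn u)%:R = u - sawtooth u - 2^-1.
Proof.
move=> u0; rewrite (@sawtooth_floor _ u (Num.truncn u)); first by rewrite /=; lra.
by have := truncn_itv u0; rewrite -natr1.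
Qed.

(** The tail is dominated by that of the telescoping series of
    [1 / n - 1 / (n + 1)]. *)
Lemma series_tail (R : realType) (f : nat -> R) (M : nat) :
  (forall m, 0 <= f m <= 1) ->
  let P N := \sum_(1 <= n < N) f n / (n%:R * n.+1%:R) in
  cvgn P -> P M.+1 <= limn P <= P M.+1 + M.+1%:R^-1.
Proof.
move=> f01 P cP.
have step (p i w b a : R) : a <= b -> p + i - (w + b) + a <= p + i - w by lra.
have ndP : nondecreasing_seq P.
  apply/nondecreasing_seqP => -[|n]; first by rewrite /P !big_geq.
  rewrite /P [leRHS]big_nat_recr//= lerDl divr_ge0 ?mulr_ge0//.
  by case/andP: (f01 n.+1).
apply/andP; split; first exact: nondecreasing_cvgn_le.
apply: limr_le => //; apply: nearW => N.
have [NM|MN] := leqP N M.+1.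
  by apply: (le_trans (ndP _ _ NM)); rewrite lerDl.
rewrite -(subnK (ltnW MN)); move: (N - M.+1)%N => k {N MN}.
suff : P (k + M.+1)%N <= P M.+1 + M.+1%:R^-1 - (k + M.+1)%:R^-1.
  by move=> /le_trans; apply; rewrite lerBlDr lerDl.
elim: k => [|k IH]; first by rewrite add0n addrK.
rewrite addSn {1}/P big_nat_recr ?addn_gt0 ?orbT//= -/(P _).
apply: (le_trans (lerD IH (lexx _))).
have n0 : 0 < (k + M.+1)%:R :> R by rewrite ltr0n addn_gt0 orbT.
rewrite -[(k + M.+1).+1%:R]natr1; move: n0; set w := (k + M.+1)%:R => n0.
have -> : w^-1 = (w + 1)^-1 + (w * (w + 1))^-1 by field; lra.
have /andP[f0 f1] := f01 (k + M.+1)%N.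
have : f (k + M.+1)%N / (w * (w + 1)) <= 1 / (w * (w + 1)).
  by rewrite ler_wpM2r// invr_ge0 mulr_ge0; lra.
rewrite mul1r; exact: step.
Qed.

Lemma mu2_01 (R : realDomainType) (m : nat) : 0 <= ((mu2 m)%:~R : R) <= 1.
Proof. by rewrite mu2E; case: squarefree; rewrite /= ?lexx ?ler01. Qed.

(** The cutoff [M = floor (y ^ 10)] makes both [x / (M + 1)] and the sawtooth
    sums [O(y ^ 8)].  The constants [1/2] in the two sawtooths cancel. *)
Lemma sum_mu2_truncn (R : realType) (y : R) :
  0 < y -> 32 < y ^+ 2 ->
  `|\sum_(1 <= n < (Num.truncn (y ^+ 18)).+1) (mu2 (Num.truncn (y ^+ 18 / n%:R)))%:~R
    - y ^+ 18 * limn (fun N => \sum_(1 <= n < N) (mu2 n)%:~R / (n%:R * n.+1%:R) : R)|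
  <= (2 + 8 * 4120) * y ^+ 8.
Proof.
move=> y0 y32; set x := y ^+ 18.
have combine (S P L U V t E B : R) :
    `|S - (P - U + V)| <= t -> t <= E -> P <= L -> L <= P + t ->
    `|U| <= B -> `|V| <= B -> `|S - L| <= 2 * E + 2 * B.
  rewrite !ler_norml => /andP[s1 s2] tE PL LP /andP[u1 u2] /andP[v1 v2].
  by apply/andP; split; lra.
have x0 : 0 < x by rewrite exprn_gt0.
pose f (m : nat) : R := (mu2 m)%:~R.
have f01 m : 0 <= f m <= 1 by exact: mu2_01.
pose M := Num.truncn (y ^+ 10).
have /andP[M1 M2] : M%:R <= y ^+ 10 < M.+1%:R.
  by apply: truncn_itv; rewrite exprn_ge0// ltW.
have xM : x / M.+1%:R <= y ^+ 8.
  rewrite ler_pdivrMr// (_ : x = y ^+ 8 * y ^+ 10); last by rewrite /x; ring.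
  by rewrite ler_wpM2l ?ltW// exprn_gt0.
have h1 := @sum_truncn_div R f x M (ltW x0) f01.
have /andP[h2 h3] := @series_tail R f M f01 (@is_cvg_series_mu2 R).
have h4 := @sum_mu2_sawtooth R M y 0 y0 y32 M1 ltac:(lra).
have h5 := @sum_mu2_sawtooth R M y 1 y0 y32 M1 ltac:(lra).
have e : \sum_(1 <= m < M.+1)
      f m * ((Num.truncn (x / m%:R))%:R - (Num.truncn (x / m.+1%:R))%:R) =
    x * (\sum_(1 <= n < M.+1) f n / (n%:R * n.+1%:R)) -
    \sum_(1 <= m < M.+1) f m * sawtooth (x / (m%:R + 0)) +
    \sum_(1 <= m < M.+1) f m * sawtooth (x / (m%:R + 1)).
  rewrite mulr_sumr -sumrB -big_split /=; apply: eq_big_nat => m /andP[m0 _].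
  have mR : 1 <= m%:R :> R by rewrite ler1n.
  rewrite !sawtooth_truncn ?divr_ge0 ?(ltW x0)// addr0 -[m.+1%:R]natr1.
  by field; lra.
rewrite e in h1.
have h6 := ler_wpM2l (ltW x0) h2.
have := ler_wpM2l (ltW x0) h3; rewrite mulrDr => h7.
have -> : (2 + 8 * 4120) * y ^+ 8 = 2 * y ^+ 8 + 2 * (4 * 4120 * y ^+ 8) by ring.
exact: combine h1 xM h6 h7 h4 h5.
Qed.

Theorem theorem1p4 (R : realType) (eps : R) (eps_gt0 : 0 < eps) :
  exists C x0 : R, expR 1 <= x0 /\
    forall x : R, x0 <= x ->
      `| \sum_(1 <= n < (Num.truncn x).+1) (mu2 (Num.truncn (x / n%:R)))%:~R
         - x * limn (fun N => \sum_(1 <= n < N)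
                       (mu2 n)%:~R / (n%:R * n.+1%:R) : R) |
      <= C * x `^ (1919 / 4268 + eps).
Proof.
exists (2 + 8 * 4120), (expR 1 + 33 ^+ 9); split; first by rewrite lerDl exprn_ge0.
move=> x xx0.
have x33 : 33 ^+ 9 <= x by apply: le_trans xx0; rewrite lerDr ltW// expR_gt0.
have x1 : 1 <= x by apply: le_trans x33; rewrite exprn_ege1//; lra.
have xge0 : 0 <= x by lra.
pose y := x `^ 18^-1.
have y0 : 0 < y by rewrite powR_gt0; lra.
have yn n : y ^+ n = x `^ (n%:R / 18).
  by rewrite -powR_mulrn ?ltW// -powRrM mulrC.
have y18 : y ^+ 18 = x by rewrite yn divff// powRr1.
(* [y ^ 2] is the ninth root of [x >= 33 ^ 9]. *)
have y32 : 32 < y ^+ 2.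
  apply: (@lt_le_trans _ _ 33); first by lra.
  by rewrite -(@ler_pXn2r _ 9) ?nnegrE ?exprn_ge0 ?(ltW y0)// -exprM y18.
have := sum_mu2_truncn y0 y32; rewrite y18 => /le_trans; apply.
apply: ler_wpM2l; first by apply: addr_ge0; [|apply: mulr_ge0]; exact: ler0n.
by rewrite yn; apply: ler_powR => //; lra.
Qed.
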